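(* Let $n\ge1$, $\alpha\in(0,1)$, let $\{1,\dots,n\}=I_0\cup I_1$ be a disjoint union with $n_0=|I_0|>0$, and let $\alpha_1\le\dots\le\alpha_n$ be deterministic critical values. Consider the following conditions on a $[0,1]^n$-valued random vector $p=(p_1,\dots,p_n)$ of p-values: 1. $(p_i)_{i\in\{1,\dots,n\}}$ is positive regression dependent on $I_0$ (PRDS): for each $i\in I_0$ and every coordinate-wise increasing, integrable function $f:[0,1]^n\to\mathbb{R}$, the map $x\mapsto\mathbb{E}[f(p_1,\dots,p_n)\mid p_i=x]$ is increasing; 2. $(p_i)_{i\in I_0}$ and $(p_i)_{i\in I_1}$ are stochastically independent; 3. each $p_i$, $i\in I_0$, is stochastically larger than the uniform distribution on $(0,1)$, i.e. $P(p_i\le x)\le x$ for all $x\in[0,1]$. Assume that 4. the step down procedure using critical values $\alpha_i$, $i\le n$, controls the FDR at level $\alpha$ under 1.-3., i.e. its FDR is at most $\alpha$ for every $p$ satisfying 1.-3. Then the step down procedure using critical values $$c_i=\max\left(\alpha_i,\,1-(1-\alpha)^{1/n}\right),\qquad i\le n,$$ controls the FDR at level $\alpha$, i.e. its FDR is at most $\alpha$ for every $p$ satisfying 1.-3.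
   Context: $I_0$ is the index set of true null hypotheses and $I_1$ that of false ones. $p_{1:n}\le\dots\le p_{n:n}$ denote the ordered p-values. For critical values $d_1\le\dots\le d_n$ the step down (SD) critical boundary value is $\tau_{SD}=\max\{d_i: p_{j:n}\le d_j \text{ for all } j\le i\}$ with $\max\emptyset=0$; hypotheses with $p_i\le\tau_{SD}$ are rejected. With $V(\tau)=\sum_{i\in I_0}\mathbb{I}(p_i\le\tau)$ and $R(\tau)=\sum_{i=1}^n\mathbb{I}(p_i\le\tau)$, the false discovery rate of the procedure is $\mathrm{FDR}=\mathbb{E}\left[\frac{V(\tau_{SD})}{R(\tau_{SD})}\right]$ with the convention $\frac00=0$. ''Increasing'' means non-decreasing.
   Formalization: The critical values α_i are assumed nonnegative; without this the claim fails, e.g. n=2, I_0={1}, α_1=-1, α_2=0.9, α=0.1 with p_1 uniform and p_2=0, where the original FDR is 0 and the modified FDR is 0.45. *)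

(* Defs.v *)
From HB Require Import structures.
From mathcomp Require Import all_boot all_order all_algebra.
From mathcomp Require Import all_classical all_reals all_analysis.

Set Implicit Arguments.
Unset Strict Implicit.
Unset Printing Implicit Defensive.

Import Order.TTheory GRing.Theory Num.Theory.
Import numFieldNormedType.Exports.

Local Open Scope classical_set_scope.
Local Open Scope ring_scope.

Section StepDown.
Context {R : realType} {n : nat}.

(* Positions start at 0, so p_{k:n} is [order_stat v (k - 1)]. *)
Definition order_stat (v : n.-tuple R) (j : nat) : R := (sort <=%R v)`_j.

(* The base 0 is the convention max(empty) = 0; it is absorbed as soon as an
   index qualifies, because critical values are nonnegative. *)
Definition tauSD (d : 'I_n -> R) (v : n.-tuple R) : R :=
  \big[Num.max/0]_(i < n |
    [forall j : 'I_n, (j <= i)%N ==> (order_stat v j <= d j)]) d i.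

Definition Vcount (I0 : {set 'I_n}) (v : n.-tuple R) (t : R) : nat :=
  (\sum_(i in I0) (tnth v i <= t)%R)%N.

Definition Rcount (v : n.-tuple R) (t : R) : nat :=
  (\sum_(i < n) (tnth v i <= t)%R)%N.

(* 0 / 0 = 0 holds because 0^-1 = 0. *)
Definition FDP_SD (I0 : {set 'I_n}) (d : 'I_n -> R) (v : n.-tuple R) : R :=
  (Vcount I0 v (tauSD d v))%:R / (Rcount v (tauSD d v))%:R.

Definition cube : set (n.-tuple R) :=
  [set v | forall i, 0 <= tnth v i <= 1].

End StepDown.
Arguments cube : clear implicits.

Section RandomPvalues.
Context {d : measure_display} {T : measurableType d} {R : realType}.
Variable P : probability T R.

(* [g] is a version of x |-> E[X | Y = x]. *)
Definition is_cond_expectation (X Y : T -> R) (g : R -> R) : Prop :=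
  [/\ measurable_fun setT g,
      P.-integrable setT (EFin \o (g \o Y)) &
      forall B : set R, measurable B ->
        (\int[P]_(w in Y @^-1` B) (g (Y w))%:E
         = \int[P]_(w in Y @^-1` B) (X w)%:E)%E].

Context {n : nat}.
Implicit Types (p : {RV P >-> n.-tuple R}) (I : {set 'I_n}).

Definition pval p (i : 'I_n) : T -> R := fun w => tnth (p w) i.

(* Functions on [0,1]^n (resp. [0,1]) are represented by functions on R^n
   (resp. R) whose values off the cube (resp. the interval) play no role.
   Conditional expectations being defined almost surely only, x |-> E[f(p) |
   p_i = x] is increasing when one of its versions is. *)
Definition PRDS I p : Prop :=
  forall i, i \in I -> forall f : n.-tuple R -> R,
    (forall u v, cube R n u -> cube R n v ->
       (forall k, tnth u k <= tnth v k) -> f u <= f v) ->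
    measurable_fun (cube R n) f ->
    P.-integrable setT (EFin \o (f \o p)) ->
    exists2 g : R -> R,
      is_cond_expectation (f \o p) (pval p i) g &
      {in `[0, 1] &, {homo g : x y / x <= y}}.

(* The sigma-algebra generated by the p_i with i in I. *)
Definition sigma_pvals I p : set (set T) :=
  <<s \bigcup_(i in [set` I]) preimage_set_system setT (pval p i) measurable >>.

Definition indep_pvals I J p : Prop :=
  forall A B, sigma_pvals I p A -> sigma_pvals J p B ->
    (P (A `&` B) = P A * P B)%E.

Definition superuniform I p : Prop :=
  forall i, i \in I -> forall x : R, 0 <= x <= 1 ->
    (P [set w | (pval p i w <= x)%R] <= x%:E)%E.

Definition FDR_SD I0 (c : 'I_n -> R) p : \bar R := 'E_P[FDP_SD I0 c \o p]%E.

End RandomPvalues.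

Definition SD_controls_FDR (R : realType) (n : nat) (I0 I1 : {set 'I_n})
    (alpha : R) (c : 'I_n -> R) : Prop :=
  forall (d : measure_display) (T : measurableType d) (P : probability T R)
         (p : {RV P >-> n.-tuple R}),
    (forall w, cube R n (p w)) ->
    PRDS I0 p -> indep_pvals I0 I1 p -> superuniform I0 p ->
    (FDR_SD I0 c p <= alpha%:E)%E.

(* Main.v *)
Require Import Defs.
From mathcomp Require Import all_boot all_order all_algebra.
From mathcomp Require Import all_classical all_reals all_analysis.
From HB Require Import structures.
From mathcomp Require Import measurable_realfun ring lra.
Import Order.TTheory GRing.Theory Num.Theory.
Local Open Scope ring_scope.

(** Let k = 1 - (1 - alpha)^(1/n), so that (1 - k)^n = 1 - alpha, and let c be
    the pointwise maximum of the critical values a and of k.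

    Since the p-values of true and of false hypotheses are independent, the FDR
    is an average, over the values v of the p-values of false hypotheses, of the
    FDR obtained when these are frozen at v ([FDR_SD_mix_le]).  It is therefore
    enough to bound the FDR for each frozen v.  Freezing preserves PRDS,
    independence and superuniformity, so the hypothesis on a applies to frozen
    vectors as well.  Let K be the number of coordinates of v that are at most k.

    If every critical value of a from the (K+1)-st on is at least k, then the
    procedure with c, run with v, has the same false discovery proportion as the
    procedure with a, run after the K small coordinates of v have been replaced
    by 0 ([FDP_SD_squash]).  The hypothesis on a, applied to this modified frozen
    vector, bounds the FDR by alpha.

    Otherwise the (K+1)-st critical value of c is k.  When all p-values of true
    nulls exceed k, only K p-values are at most k, so the procedure stops with
    threshold at most k and rejects no true null ([FDP_SD_le_indic]).  Hence the
    FDR is at most the probability that some true null has a p-value at most k.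
    Under PRDS the events that a given true null p-value exceeds k are
    positively associated ([PRDS_pval_gt_assoc]), and by superuniformity each
    has probability at least 1 - k, so all of them occur together with
    probability at least (1 - k)^|I0|, which is at least (1 - k)^n = 1 - alpha
    ([PRDS_orthant]). *)

(** * Step-down procedures on a fixed vector of p-values *)

Section Deterministic.
Context {R : realType} {n : nat}.
Implicit Types (u v : n.-tuple R) (d : 'I_n -> R) (I J : {set 'I_n}).

(** The coordinates of [u] on [I] and those of [v] off [I]. *)
Definition mix I u v : n.-tuple R :=
  [tuple if i \in I then tnth u i else tnth v i | i < n].

(** The coordinates that are at most [k] are replaced by 0. *)
Definition squash (k : R) v : n.-tuple R :=
  [tuple if tnth v i <= k then 0 else tnth v i | i < n].

Lemma tnth_mix I u v i :
  tnth (mix I u v) i = if i \in I then tnth u i else tnth v i.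
Proof. exact: tnth_mktuple. Qed.

Lemma mix_id I v : mix I v v = v.
Proof. by apply: eq_from_tnth => i; rewrite tnth_mix if_same. Qed.

Lemma cube_mix I u v : cube R n u -> cube R n v -> cube R n (mix I u v).
Proof. by move=> cu cv i; rewrite tnth_mix; case: ifP. Qed.

Lemma cube_squash k v : cube R n v -> cube R n (squash k v).
Proof.
by move=> cv i; rewrite tnth_mktuple; case: ifP => // _; rewrite lexx ler01.
Qed.

Lemma Rcount_count v (t : R) : Rcount v t = count (fun x => x <= t) v.
Proof.
rewrite /Rcount -sum1_count big_tuple [RHS]big_mkcond /=.
by apply: eq_bigr => i _; case: ifP.
Qed.

(** The step-down comparisons, expressed by counts instead of sorting: with
    positions starting at 0, the p-value at position j in increasing order is at
    most [t] exactly when more than j p-values are. *)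
Lemma order_stat_le v (j : 'I_n) (t : R) :
  (order_stat v j <= t) = (j < Rcount v t)%N.
Proof.
rewrite Rcount_count -(count_sort <=%R).
have srt : sorted <=%R (sort <=%R v) by apply: sort_sorted; exact: le_total.
apply/idP/idP => [|lt_j]; last exact: (nth_count_le 0 srt).
apply: contraLR; rewrite -leqNgt -ltNge => ge_j.
by apply: (nth_count_gt 0 srt); rewrite ge_j size_sort size_tuple ltn_ord.
Qed.

Lemma tauSD_Rcount d v :
  tauSD d v = \big[Num.max/0]_(i < n |
    [forall j : 'I_n, (j <= i)%N ==> (j < Rcount v (d j))%N]) d i.
Proof.
apply: eq_bigl => i; apply: eq_forallb => j.
by rewrite order_stat_le.
Qed.

Lemma le_Rcount v (s t : R) : s <= t -> (Rcount v s <= Rcount v t)%N.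
Proof.
move=> st; apply: leq_sum => i _.
by case: (leP _ s) => // /le_trans -> //.
Qed.

Lemma Vcount_mixr I u v (t : R) :
  Vcount (~: I) (mix I u v) t = Vcount (~: I) v t.
Proof.
by apply: eq_bigr => i; rewrite inE tnth_mix => /negbTE->.
Qed.

Lemma Vcount_setC I v (t : R) :
  (Vcount I v t + Vcount (~: I) v t)%N = Rcount v t.
Proof.
rewrite /Rcount (bigID (mem I)) /=; congr addn.
by apply: eq_bigl => i; rewrite inE.
Qed.

Lemma Vcount_eq0 I v (s t : R) :
  s <= t -> (forall i, i \in I -> t < tnth v i) -> Vcount I v s = 0%N.
Proof.
move=> st H; apply: big1 => i iI.
by rewrite leNgt (le_lt_trans st (H i iI)).
Qed.

Lemma FDP_SD_ge0 I d v : 0 <= FDP_SD I d v.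
Proof. by rewrite divr_ge0. Qed.

Lemma FDP_SD_le1 I d v : FDP_SD I d v <= 1.
Proof.
rewrite /FDP_SD; set t := tauSD d v.
have [->|R0] := eqVneq (Rcount v t) 0%N; first by rewrite invr0 mulr0.
rewrite ler_pdivrMr ?ltr0n ?lt0n // mul1r ler_nat -(Vcount_setC I).
exact: leq_addr.
Qed.

(** The false discovery proportion depends on the p-values only through their
    comparisons with 0 and with the critical values. *)
Lemma eq_FDP_SD I d u v :
    (forall i, (tnth u i <= 0) = (tnth v i <= 0)) ->
    (forall i j, (tnth u i <= d j) = (tnth v i <= d j)) ->
  FDP_SD I d u = FDP_SD I d v.
Proof.
move=> eq0 eqd.
have eqtau : tauSD d u = tauSD d v.
  rewrite !tauSD_Rcount; apply: eq_bigl => i; apply: eq_forallb => j.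
  by congr (_ ==> (_ < _)%N); apply: eq_bigr => k _; rewrite eqd.
have eqt i : (tnth u i <= tauSD d v) = (tnth v i <= tauSD d v).
  rewrite /tauSD; elim/big_ind: _ => // x y Hx Hy.
  by rewrite /Order.max; case: ifP.
rewrite /FDP_SD eqtau; congr (_%:R / _%:R).
  by apply: eq_bigr => k _; rewrite eqt.
by apply: eq_bigr => k _; rewrite eqt.
Qed.

(** Effect of raising the critical values [a] to at least [k], where [I] is the
    set of true nulls. *)
Section Raise.
Variables (I : {set 'I_n}) (a : 'I_n -> R) (k : R).
Hypothesis a_ge0 : forall i, 0 <= a i.
Hypothesis a_mono : forall i j : 'I_n, (i <= j)%N -> a i <= a j.
Hypothesis k_gt0 : 0 < k.
Let c i := Num.max (a i) k.

Lemma Rcount_squash v (t : R) :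
  k <= t -> Rcount (mix I v (squash k v)) t = Rcount v t.
Proof.
move=> kt; apply: eq_bigr => i _; rewrite tnth_mix tnth_mktuple.
case: ifP => // _; case: (leP _ k) => // vk.
by rewrite (le_trans vk kt) (le_trans _ kt) // ltW.
Qed.

Lemma Rcount_squash_ge v (t : R) :
  0 <= t -> (Vcount (~: I) v k <= Rcount (mix I v (squash k v)) t)%N.
Proof.
move=> t0; rewrite -(Vcount_setC I); apply: leq_trans (leq_addl _ _).
apply: leq_sum => i; rewrite inE => /negbTE iI.
rewrite tnth_mix iI tnth_mktuple.
by case: (leP _ k) => // _; rewrite t0.
Qed.

(** If at least as many false hypotheses have a p-value at most [k] as there are
    critical values below [k], then raising the critical values to [k] has the
    same effect on the false discovery proportion as lowering these p-values
    to 0.  Indeed, the same steps are passed in both procedures. *)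
Lemma FDP_SD_squash v :
    (forall j : 'I_n, (Vcount (~: I) v k <= j)%N -> k <= a j) ->
  FDP_SD I c v = FDP_SD I a (mix I v (squash k v)).
Proof.
set K := Vcount _ _ _ => Ka; set v' := mix I v _.
have early (j : 'I_n) : (j < K)%N -> (j < Rcount v' (a j))%N.
  by move=> jK; apply: leq_trans jK (Rcount_squash_ge v _ (a_ge0 j)).
have passE (j : 'I_n) : (j < Rcount v (c j))%N = (j < Rcount v' (a j))%N.
  have [ka|ak] := leP k (a j).
    by rewrite /c (max_l ka) Rcount_squash.
  have jK : (j < K)%N.
    by rewrite ltnNge; apply: contraTN ak => /Ka; rewrite leNgt.
  rewrite early // /c (max_r (ltW ak)) -(Vcount_setC I).
  by rewrite (leq_trans jK) // leq_addl.
(* [Q i]: steps 0 to i are all passed, for either procedure. *)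
pose Q := [pred i : 'I_n | [forall j : 'I_n,
             (j <= i)%N ==> (j < Rcount v' (a j))%N]].
have tau_a : tauSD a v' = \big[Num.max/0]_(i < n | Q i) a i.
  exact: tauSD_Rcount.
have tau_c : tauSD c v = \big[Num.max/0]_(i < n | Q i) c i.
  rewrite tauSD_Rcount; apply: eq_bigl => i.
  by apply: eq_forallb => j; rewrite passE.
have Veq t : Vcount I v' t = Vcount I v t.
  by apply: eq_bigr => i iI; rewrite tnth_mix iI.
have [/existsP[i0 /andP[Qi0 ki0]]|] := boolP [exists i, Q i && (k <= a i)].
  have a_tau i : Q i -> a i <= tauSD a v'.
    by move=> Qi; rewrite tau_a; apply: le_bigmax_cond.
  have k_tau : k <= tauSD a v' := le_trans ki0 (a_tau _ Qi0).
  have -> : FDP_SD I a v' = (Vcount I v (tauSD a v'))%:R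
                          / (Rcount v (tauSD a v'))%:R.
    by rewrite /FDP_SD Veq Rcount_squash.
  suff -> : tauSD a v' = tauSD c v by [].
  apply/le_anti/andP; split.
    rewrite tau_a tau_c; apply: le_bigmax2 => i _.
    by rewrite /c le_max lexx.
  rewrite tau_c; apply: bigmax_le; first exact: le_trans (ltW k_gt0) k_tau.
  by move=> i Qi; rewrite /c ge_max a_tau.
(* Otherwise the procedure stops at critical values below [k].  Then step K is
   not passed (or K = n), which leaves no true null p-value that is at most
   [k], and both proportions vanish. *)
rewrite negb_exists => /forallP noQ.
have small i : Q i -> a i <= k.
  by move=> Qi; have := noQ i; rewrite Qi /= -ltNge => /ltW.
have RK : (Rcount v k <= K)%N.
  have [Kn|nK] := ltnP K n; last first.
    apply: leq_trans nK; rewrite Rcount_count.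
    by rewrite (leq_trans (count_size _ _)) // size_tuple.
  have kaK := Ka (Ordinal Kn) (leqnn _).
  have := noQ (Ordinal Kn); rewrite kaK andbT negb_forall => /existsP[j].
  rewrite negb_imply -leqNgt => /andP[jK Rj].
  have Kj : (K <= j)%N.
    by rewrite leqNgt; apply/negP => /early; rewrite ltnNge Rj.
  have kaj : k <= a j := Ka j Kj.
  apply: leq_trans (leq_trans Rj jK).
  by rewrite Rcount_squash ?le_Rcount.
have V0 : Vcount I v k = 0%N.
  by apply/eqP; rewrite -leqn0 -(leq_add2r K) add0n Vcount_setC.
have V0' t : t <= k -> Vcount I v t = 0%N.
  move=> tk; apply/eqP; rewrite -leqn0 -V0; apply: leq_sum => i _.
  by case: (leP _ t) => // /le_trans -> //.
rewrite /FDP_SD Veq !V0' ?mul0r //.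
  by rewrite tau_a; apply: bigmax_le => //; exact: ltW.
rewrite tau_c; apply: bigmax_le; first exact: ltW.
by move=> i Qi; rewrite /c ge_max lexx small.
Qed.

(** With fewer small p-values of false hypotheses, no true null is rejected
    unless some true null has a p-value that is at most [k]. *)
Lemma FDP_SD_le_indic v (j : 'I_n) :
    (Vcount (~: I) v k <= j)%N -> a j < k ->
  FDP_SD I c v <= (~~ [forall i in I, k < tnth v i])%:R.
Proof.
set K := Vcount _ _ _ => Kj ajk.
case: (boolP [forall i in I, _]) => [|_]; last exact: FDP_SD_le1.
move=> /forall_inP nullk /=.
have RK : Rcount v k = K.
  by rewrite -(Vcount_setC I) (Vcount_eq0 _ _ _ _ (lexx k)).
suff tk : tauSD c v <= k by rewrite /FDP_SD (Vcount_eq0 _ _ _ _ tk) ?mul0r.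
have ck (i : 'I_n) : (i <= j)%N -> c i = k.
  by move=> /a_mono aij; rewrite /c max_r // (le_trans aij) ?ltW.
rewrite tauSD_Rcount; apply: bigmax_le => [|i]; first exact: ltW.
have Kn : (K < n)%N := leq_ltn_trans Kj (ltn_ord j).
move=> /forallP/(_ (Ordinal Kn)) /=.
rewrite ck //= RK ltnn implybF -ltnNge => iK.
by rewrite ck // (leq_trans _ Kj) // ltnW.
Qed.

End Raise.
End Deterministic.

(** * Random p-values with the false hypotheses frozen *)

Section Probability.
Local Open Scope classical_set_scope.
Local Open Scope ring_scope.

Lemma measurable_cube (R : realType) n : measurable (cube R n).
Proof.
have -> : cube R n =
    \bigcap_(i in [set: 'I_n]) ((fun u => tnth u i) @^-1` `[0, 1]).
  apply/seteqP; split=> u cu i.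
    by move=> _; have := cu i; rewrite /preimage /= in_itv.
  by have := cu i I; rewrite /preimage /= in_itv.
apply: fin_bigcap_measurable => [|i _]; first exact: finite_finset.
by rewrite -[X in measurable X]setTI; apply: measurable_tnth.
Qed.

Lemma measurable_mixl (R : realType) n (I : {set 'I_n}) (v : n.-tuple R) :
  measurable_fun setT (fun u : n.-tuple R => mix I u v).
Proof.
apply/measurable_fun_tnthP => i.
have [iI|iI] := boolP (i \in I).
  rewrite (_ : _ \o _ = fun u => tnth u i); first exact: measurable_tnth.
  by apply: funext => u /=; rewrite tnth_mix iI.
rewrite (_ : _ \o _ = cst (tnth v i)); first exact: measurable_cst.
by apply: funext => u /=; rewrite tnth_mix (negbTE iI).
Qed.

Section Pvalues.
Context {dT : measure_display} {T : measurableType dT} {R : realType}.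
Context {P : probability T R} {n : nat}.
Implicit Types (I J : {set 'I_n}) (v : n.-tuple R).

(** The random vector [p] with its coordinates off [I] frozen at [v], first as a
    function, then as a random variable. *)
Definition mix_fun (p : {RV P >-> n.-tuple R}) I v (w : T) : n.-tuple R :=
  mix I (p w) v.

Lemma measurable_mix_fun p I v : measurable_fun setT (mix_fun p I v).
Proof.
exact: (measurableT_comp (measurable_mixl R n I v) (measurable_funPT p)).
Qed.

HB.instance Definition _ p I v :=
  isMeasurableFun.Build _ _ T (n.-tuple R) (mix_fun p I v)
    (measurable_mix_fun p I v).

Definition mix_rv (p : {RV P >-> n.-tuple R}) I v : {RV P >-> n.-tuple R} :=
  mix_fun p I v.

Variable p : {RV P >-> n.-tuple R}.

Lemma pval_mix_rv I v i : i \in I -> pval (mix_rv p I v) i = pval p i.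
Proof. by move=> iI; apply: funext => w; rewrite /pval tnth_mix iI. Qed.

Lemma PRDS_mix_rv I v : cube R n v -> PRDS I p -> PRDS I (mix_rv p I v).
Proof.
move=> cv prds i iI f fmono mf intf.
rewrite pval_mix_rv //; apply: (prds i iI (fun u => f (mix I u v))) => //.
  move=> u u' cu cu' uu'; apply: fmono; [exact: cube_mix..|].
  by move=> k; rewrite !tnth_mix; case: ifP.
apply: (measurable_comp (measurable_cube R n) _ mf) => [_ [u cu <-]|].
  exact: cube_mix.
by apply: measurable_funTS; exact: measurable_mixl.
Qed.

Lemma superuniform_mix_rv I v :
  superuniform I p -> superuniform I (mix_rv p I v).
Proof. by move=> su i iI x x01; rewrite pval_mix_rv //; exact: su. Qed.

(** Constant p-values generate the trivial sigma-algebra. *)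
Lemma sigma_pvals_const I v A :
  sigma_pvals (~: I)%SET (mix_rv p I v) A -> A = set0 \/ A = setT.
Proof.
pose triv : set (set T) := [set A | A = set0 \/ A = setT].
suff sub_triv : sigma_pvals (~: I)%SET (mix_rv p I v) `<=` triv.
  exact: sub_triv.
apply: smallest_sub.
  split=> [|B [->|->]|F HF] /=; first by left.
  - by right; rewrite setTD setC0.
  - by left; rewrite setTD setCT.
  - have [[i Fi]|nF] := pselect (exists i, F i = setT).
      by right; apply/seteqP; split=> // w _; exists i => //; rewrite Fi.
    left; rewrite -subset0 => w [i _]; case: (HF i) => [->//|Fi].
    by case: nF; exists i.
move=> C [i /=]; rewrite inE => iI [B _ <-].
rewrite setTI; have [vB|vB] := pselect (B (tnth v i)); [right|left].
  apply/seteqP; split=> // w _.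
  by rewrite /preimage /pval /= tnth_mix (negbTE iI).
rewrite -subset0 => w.
by rewrite /preimage /pval /= tnth_mix (negbTE iI).
Qed.

Lemma indep_pvals_mix_rv I v : indep_pvals I (~: I)%SET (mix_rv p I v).
Proof.
move=> A B _ /sigma_pvals_const[->|->].
  by rewrite setI0 measure0 mule0.
by rewrite setIT probability_setT mule1.
Qed.

Lemma probability_fineK (A : set T) :
  measurable A -> P A = (fine (P A))%:E.
Proof. by move=> mA; rewrite fineK // fin_num_measure. Qed.

Lemma measurable_pval i : measurable_fun setT (pval p i).
Proof.
exact: (measurableT_comp (measurable_tnth i) (measurable_funPT p)).
Qed.

Lemma measurable_pval_gt (k : R) i : measurable [set w | k < pval p i w].
Proof.
rewrite -[X in measurable X]setTI.
have -> : [set w | k < pval p i w] = pval p i @^-1` `]k, +oo[.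
  by apply/seteqP; split=> w; rewrite /preimage /= in_itv /= andbT.
exact: measurable_pval.
Qed.

Lemma measurable_all_pval_gt (k : R) (s : seq 'I_n) :
  measurable [set w | all (fun i => k < pval p i w) s].
Proof.
elim: s => [|i s IH]; first by rewrite set_true.
rewrite (_ : [set _ | _] = [set w | k < pval p i w]
   `&` [set w | all (fun i => k < pval p i w) s]).
  exact: measurableI (measurable_pval_gt _ _) IH.
by apply/seteqP; split=> w /= => [/andP[]|[-> ->]].
Qed.

(** The conditional probability [g] of the event on [s] given [p_i] is
    increasing, hence at least [g k] where [p_i > k] and at most [g k] elsewhere:
    this is Chebyshev's association inequality for [g] and the indicator of
    [p_i > k]. *)
Lemma PRDS_pval_gt_assoc I (k : R) i (s : seq 'I_n) :
    (forall w, cube R n (p w)) -> PRDS I p -> i \in I -> 0 <= k <= 1 ->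
  (P [set w | (k < pval p i w)%R]
     * P [set w | all (fun j => k < pval p j w)%R s]
   <= P [set w | all (fun j => k < pval p j w)%R (i :: s)])%E.
Proof.
move=> pc prds iI k01.
set B := [set w | k < pval p i w]; set A := [set w | all _ s].
have -> : [set w | all (fun j => k < pval p j w) (i :: s)] = A `&` B.
  by apply/seteqP; split=> w /= => [/andP[]|[-> ->]].
have mA : measurable A := measurable_all_pval_gt k s.
have mB : measurable B := measurable_pval_gt k i.
have mCB : measurable (~` B) by exact: measurableC.
pose A' : set (n.-tuple R) := [set u | all (fun j => k < tnth u j) s].
have mA' : measurable A'.
  rewrite /A'; elim: (s) => [|j r IH]; first by rewrite set_true.
  rewrite (_ : [set _ | _] = (fun u => tnth u j) @^-1` `]k, +oo[
     `&` [set u | all (fun j => k < tnth u j) r]).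
    apply: measurableI IH; rewrite -[X in measurable X]setTI.
    exact: measurable_tnth.
  apply/seteqP; split=> u; rewrite /preimage /= in_itv /= andbT.
    by move=> /andP[].
  by move=> [-> ->].
have fA : (\1_A' : n.-tuple R -> R) \o p = \1_A.
  by apply: funext => w; rewrite /= !indicE; congr (nat_of_bool _)%:R.
have iA : P.-integrable setT (EFin \o (\1_A : T -> R)).
  exact: integrable_indic.
have [|||g [mg ig eg] gmono] := prds i iI (\1_A' : n.-tuple R -> R).
- move=> u v cu cv uv; rewrite !indicE ler_nat.
  case: (boolP (u \in A')) => // /set_mem uA.
  suff vA : A' v by rewrite (mem_set vA).
  apply/allP => j js; apply: lt_le_trans (uv j).
  by move/allP: uA => /(_ j js).
- exact: measurable_realfun.measurable_indic.
- by rewrite fA.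
have EB : (\int[P]_(w in B) (g (pval p i w))%:E = P (A `&` B))%E.
  have -> : B = pval p i @^-1` `]k, +oo[.
    by apply/seteqP; split=> w; rewrite /B /preimage /= in_itv /= andbT.
  rewrite eg // fA integral_indic //.
  rewrite -[X in measurable X]setTI; exact: measurable_pval.
have ECB : (\int[P]_(w in ~` B) (g (pval p i w))%:E = P (A `&` ~` B))%E.
  have -> : ~` B = pval p i @^-1` `]-oo, k].
    apply/seteqP; split=> w; rewrite /B /preimage /= in_itv /=.
      by move/negP; rewrite -leNgt.
    by move=> pk; apply/negP; rewrite -leNgt.
  rewrite eg // fA integral_indic //.
  rewrite -[X in measurable X]setTI; exact: measurable_pval.
have kin : k \in `[0, 1] by rewrite in_itv.
have pin w : pval p i w \in `[0, 1] by rewrite in_itv /=; exact: pc.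
have lowB : ((g k)%:E * P B <= P (A `&` B))%E.
  rewrite -EB -integral_cst //; apply: le_integral => //.
  - exact: finite_measure_integrable_cst.
  - exact: integrableS ig.
  - by move=> w /set_mem Bw; rewrite lee_fin gmono // ltW.
have uppB : (P (A `&` ~` B) <= (g k)%:E * P (~` B))%E.
  rewrite -ECB -integral_cst //; apply: le_integral => //.
  - exact: integrableS ig.
  - exact: finite_measure_integrable_cst.
  - move=> w /set_mem /negP; rewrite -leNgt => Bw.
    by rewrite lee_fin gmono.
have PA : (P A = P (A `&` B) + P (A `&` ~` B))%E.
  rewrite -measureU //; last 3 first.
  - exact: measurableI.
  - exact: measurableI.
  - by rewrite setIACA setICr setI0.
  by rewrite -setIUr setUv setIT.
have PCB := probability_setC P mB.
move: lowB uppB PCB; rewrite PA.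
rewrite (probability_fineK B mB) (probability_fineK _ mCB).
rewrite (probability_fineK _ (measurableI _ _ mA mB)).
rewrite (probability_fineK _ (measurableI _ _ mA mCB)).
have : 0 <= fine (P B) by exact: fine_ge0.
have : 0 <= fine (P (~` B)) by exact: fine_ge0.
move: (fine (P B)) (fine (P (~` B))) => b b'.
move: (fine (P (A `&` B))) (fine (P (A `&` ~` B))) => x y b'0 b0.
rewrite -!EFinD -!EFinM !lee_fin => lB uB [b'E].
rewrite -subr_ge0.
have -> : x - b * (x + y) = (x - g k * b) * b' + b * (g k * b' - y).
  by rewrite b'E; ring.
by rewrite addr_ge0 // mulr_ge0 // subr_ge0.
Qed.

Lemma PRDS_orthant I (k : R) (s : seq 'I_n) :
    (forall w, cube R n (p w)) -> PRDS I p -> superuniform I p ->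
    0 <= k <= 1 -> {subset s <= I} ->
  (((1 - k) ^+ size s)%:E
     <= P [set w | all (fun j => k < pval p j w)%R s])%E.
Proof.
move=> pc prds su k01; elim: s => [|i s IH] sI.
  by rewrite expr0 /= set_true probability_setT.
have iI : i \in I by rewrite sI ?mem_head.
apply: le_trans (PRDS_pval_gt_assoc I k i s pc prds iI k01).
rewrite /= exprS EFinM; apply: lee_pmul.
- by rewrite lee_fin subr_ge0; case/andP: k01.
- by rewrite lee_fin exprn_ge0 // subr_ge0; case/andP: k01.
- have -> : [set w | k < pval p i w] = ~` [set w | pval p i w <= k].
    apply/seteqP; split=> w /=; first by move=> kp; apply/negP; rewrite -ltNge.
    by move/negP; rewrite -ltNge.
  have mle : measurable [set w | pval p i w <= k].
    rewrite (_ : [set _ | _] = ~` [set w | k < pval p i w]).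
      exact/measurableC/measurable_pval_gt.
    apply/seteqP; split=> w /=; first by move=> kp; apply/negP; rewrite -leNgt.
    by move/negP; rewrite -leNgt.
  rewrite probability_setC // EFinB; apply: leeB => //.
  exact: su.
- by apply: IH => j js; rewrite sI // in_cons js orbT.
Qed.

End Pvalues.

(** * Independence and conditioning *)

Section Pattern.
Context {R : realType} {n : nat}.
Implicit Types (u v : n.-tuple R) (c : 'I_n -> R) (J : {set 'I_n}).

(** The finite record of the comparisons of the coordinates of [u] in [J] with
    the critical values, and with 0 (at [None]), which is the threshold when
    nothing is rejected.  Coordinates outside [J] are recorded as [false]. *)
Definition pattern c J u : {ffun 'I_n * option 'I_n -> bool} :=
  [ffun z => (z.1 \in J) && (tnth u z.1 <= oapp c 0 z.2)].

Lemma eq_FDP_SD_pattern I c u v u' v' :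
    pattern c I u = pattern c I u' ->
    pattern c (~: I)%SET v = pattern c (~: I)%SET v' ->
  FDP_SD I c (mix I u v) = FDP_SD I c (mix I u' v').
Proof.
move=> /ffunP eu /ffunP ev.
have H i o : (tnth (mix I u v) i <= oapp c 0 o)
           = (tnth (mix I u' v') i <= oapp c 0 o).
  rewrite !tnth_mix; have := eu (i, o); have := ev (i, o).
  by rewrite !ffunE inE /=; case: (i \in I).
apply: eq_FDP_SD => [i|i j]; first exact: (H i None).
exact: (H i (Some j)).
Qed.

End Pattern.

Lemma measurable_fun_finType d d' (T : measurableType d)
    (T' : measurableType d') (F : finType) (X : T -> F) (h : F -> T') :
    (forall x, measurable [set w | X w = x]) ->
  measurable_fun setT (h \o X).
Proof.
move=> mX _ Y mY; rewrite setTI.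
have -> : (h \o X) @^-1` Y =
    \bigcup_(x in [set x | Y (h x)]) [set w | X w = x].
  apply/seteqP; split=> w /=; first by move=> Yw; exists (X w).
  by move=> [x /= Yx Xw]; rewrite /preimage /= Xw.
by apply: fin_bigcup_measurable => [|x _]; [exact: finite_finset|exact: mX].
Qed.

Lemma expectation_finType d (T : measurableType d) (R : realType)
    (P : probability T R) (F : finType) (X : T -> F) (h : F -> R) :
    (forall x, measurable [set w | X w = x]) -> (forall x, 0 <= h x) ->
  ('E_P[h \o X] = \sum_x (h x)%:E * P [set w | X w = x])%E.
Proof.
move=> mX h0; rewrite unlock.
transitivity (\int[P]_w \sum_x ((h x)%:E * (\1_[set w | X w = x] w)%:E))%E.
  apply: eq_integral => w _; rewrite (bigD1 (X w)) //= big1 => [|x xX].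
    by rewrite adde0 indicE mem_set // mule1.
  by rewrite indicE memNset ?mule0 // => /eqP; rewrite eq_sym (negbTE xX).
rewrite ge0_integral_sum //; last 2 first.
- move=> x; apply: measurable_funeM; apply/measurable_EFinP.
  exact: measurable_indic.
- by move=> x w _; rewrite mule_ge0 ?lee_fin.
apply: eq_bigr => x _; rewrite ge0_integralZl ?lee_fin //.
- by rewrite integral_indic // setIT.
- by apply/measurable_EFinP; exact: measurable_indic.
Qed.

Section Independence.
Context {dT : measure_display} {T : measurableType dT} {R : realType}.
Context {P : probability T R} {n : nat} (p : {RV P >-> n.-tuple R}).
Implicit Types (I J : {set 'I_n}) (c : 'I_n -> R).

Lemma sigma_pvals_measurable J (A : set T) : sigma_pvals J p A -> measurable A.
Proof.
suff H : sigma_pvals J p `<=` measurable by exact: H.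
apply: smallest_sub; first exact: sigma_algebra_measurable.
by move=> C [i /= _ [B mB <-]]; exact: measurable_pval.
Qed.

Lemma sigma_pvals_pattern c J x :
  sigma_pvals J p [set w | pattern c J (p w) = x].
Proof.
rewrite /sigma_pvals; set G := \bigcup_(i in _) _.
pose T' := g_sigma_algebraType G.
have mG (A : set T') : measurable A = <<s G >> A by [].
rewrite -mG.
have -> : [set w | pattern c J (p w) = x] =
    \bigcap_(z in [set: 'I_n * option 'I_n])
      [set w | pattern c J (p w) z = x z] :> set T'.
  apply/seteqP; split=> w /= H; first by move=> z _ /=; rewrite H.
  by apply/ffunP => z; exact: (H z I).
apply: fin_bigcap_measurable => [|z _]; first exact: finite_finset.
have [zJ|zJ] := boolP (z.1 \in J); last first.
  have [xz|xz] := boolP (x z).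
    rewrite (_ : [set w | _] = set0) // -subset0 => w /=.
    by rewrite ffunE (negbTE zJ).
  rewrite (_ : [set w | _] = setT) //; apply/seteqP; split=> // w _ /=.
  by rewrite ffunE (negbTE zJ).
rewrite mG; apply: sub_sigma_algebra; exists z.1 => //=.
have mle : measurable [set r : R | r <= oapp c 0 z.2].
  by rewrite -set_itvNyc; exact: measurable_itv.
exists (if x z then [set r : R | r <= oapp c 0 z.2]
        else ~` [set r : R | r <= oapp c 0 z.2]).
  by case: (x z) => //; exact: measurableC.
rewrite setTI; apply/seteqP; split=> w; rewrite /preimage /pval /= ffunE zJ /=.
  by case: (x z) => //= /negP/negbTE.
by case: (x z) => //= ->.
Qed.

Lemma measurable_FDP_SD I c : measurable_fun setT (FDP_SD I c \o p).
Proof.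
have [v0] : inhabited (n.-tuple R) by exact: (inhabits [tuple 0 | i < n]).
pose h x := FDP_SD I c (xget v0 [set u | pattern c [set: 'I_n]%SET u = x]).
have -> : FDP_SD I c \o p = h \o (fun w => pattern c [set: 'I_n]%SET (p w)).
  apply: funext => w /=; rewrite /h.
  set S := [set u | _]; have : S (xget v0 S) by apply: xgetPex; exists (p w).
  move=> /= /ffunP eqp; have H i o := eqp (i, o).
  apply: eq_FDP_SD => [i|i j].
    by have := H i None; rewrite !ffunE !inE.
  by have := H i (Some j); rewrite !ffunE !inE.
apply: measurable_fun_finType => x.
exact: sigma_pvals_measurable (sigma_pvals_pattern _ _ _).
Qed.

(** By independence, the FDR is an average of FDRs with the coordinates off [I]
    frozen.  The false discovery proportion depends only on the patterns on [I]
    and off [I], so the average is a finite sum over the patterns off [I]. *)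
Lemma FDR_SD_mix_le I c (e : \bar R) :
    indep_pvals I (~: I)%SET p ->
    (forall w, FDR_SD I c (mix_rv p I (p w)) <= e)%E ->
  (FDR_SD I c p <= e)%E.
Proof.
move=> indep He.
pose F := {ffun 'I_n * option 'I_n -> bool}.
have [v0] : inhabited (n.-tuple R) by exact: (inhabits [tuple 0 | i < n]).
(* [rep J x] is a vector with pattern [x] on [J], if there is one. *)
pose rep J x := xget v0 [set u | pattern c J u = x].
have repP J u : pattern c J (rep J (pattern c J u)) = pattern c J u.
  pose S := [set u' | pattern c J u' = pattern c J u].
  have /= : S (xget v0 S) by apply: xgetPex; exists u.
  by [].
pose h (x y : F) := FDP_SD I c (mix I (rep I x) (rep (~: I)%SET y)).
have hE u v : FDP_SD I c (mix I u v) =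
    h (pattern c I u) (pattern c (~: I)%SET v).
  by apply: eq_FDP_SD_pattern; rewrite repP.
have h0 x y : 0 <= h x y by exact: FDP_SD_ge0.
pose A x := [set w | pattern c I (p w) = x].
pose B y := [set w | pattern c (~: I)%SET (p w) = y].
have mA x : measurable (A x).
  exact: sigma_pvals_measurable (sigma_pvals_pattern _ _ _).
have mB y : measurable (B y).
  exact: sigma_pvals_measurable (sigma_pvals_pattern _ _ _).
have condE w : FDR_SD I c (mix_rv p I (p w)) =
    (\sum_x (h x (pattern c (~: I)%SET (p w)))%:E * P (A x))%E.
  pose y := pattern c (~: I)%SET (p w).
  rewrite -(expectation_finType _ _ _ _ _ _ (h ^~ y)) //.
  by congr ('E_P[_])%E; apply: funext => w' /=; rewrite hE.
have -> : FDR_SD I c p =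
    (\sum_y (\sum_x (h x y)%:E * P (A x)) * P (B y))%E.
  pose X w : F * F := (pattern c I (p w), pattern c (~: I)%SET (p w)).
  have XE z : [set w | X w = z] = A z.1 `&` B z.2.
    apply/seteqP; split=> w /=; first by move=> <-.
    by case: z => x y [/= <- <-].
  transitivity ('E_P[(fun z => h z.1 z.2) \o X])%E.
    by congr ('E_P[_])%E; apply: funext => w /=; rewrite -hE mix_id.
  rewrite expectation_finType => [|z|z]; last 2 first.
  - by rewrite XE; exact: measurableI.
  - exact: h0.
  transitivity (\sum_x \sum_y (h x y)%:E * P [set w | X w = (x, y)])%E.
    by rewrite pair_bigA; apply: eq_bigr => -[x y] _.
  rewrite exchange_big /=; apply: eq_bigr => y _.
  rewrite ge0_sume_distrl => [|x _]; last by rewrite mule_ge0 ?lee_fin.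
  apply: eq_bigr => x _; rewrite XE /= -muleA; congr (_ * _)%E.
  by apply: indep; exact: sigma_pvals_pattern.
apply: (@le_trans _ _ (\sum_y e * P (B y))%E).
  apply: lee_sum => y _.
  (* Only patterns that occur are covered by the hypothesis. *)
  have [->|/set0P[w Bw]] := eqVneq (B y) set0.
    by rewrite measure0 !mule0.
  by apply: lee_wpmul2r => //; rewrite -Bw -condE.
have sumB : (\sum_y P (B y) = 1)%E.
  rewrite -(expectation_cst P 1).
  rewrite (expectation_finType _ _ _ P _
    (fun w => pattern c (~: I)%SET (p w)) (fun=> 1) mB (fun=> ler01)).
  by apply: eq_bigr => y _; rewrite mul1e.
by rewrite -ge0_sume_distrr // sumB mule1.
Qed.

End Independence.

(** * Raising the critical values *)

(** The general form of the result: any bound [k] that keeps the probability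
    (1 - k)^|I| of no small p-value among independent uniform true nulls at
    1 - [alpha] or more may be used. *)
Lemma SD_controls_FDR_raise (R : realType) (n : nat) (I : {set 'I_n})
    (alpha k : R) (a : 'I_n -> R) :
    (forall i, 0 <= a i) ->
    (forall i j : 'I_n, (i <= j)%N -> a i <= a j) ->
    0 < k <= 1 -> 1 - alpha <= (1 - k) ^+ #|I| ->
  SD_controls_FDR I (~: I)%SET alpha a ->
  SD_controls_FDR I (~: I)%SET alpha (fun i => Num.max (a i) k).
Proof.
move=> a_ge0 a_mono /andP[k_gt0 k_le1] kI hcontrol.
move=> d T P p pc prds indep su.
apply: FDR_SD_mix_le => // w0; set v := p w0.
have cv : cube R n v := pc w0.
have [/forallP all_ge|] :=
  boolP [forall j : 'I_n, (Vcount (~: I) v k <= j)%N ==> (k <= a j)].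
  have -> : FDR_SD I (fun i => Num.max (a i) k) (mix_rv p I v) =
            FDR_SD I a (mix_rv p I (squash k v)).
    congr ('E_P[_])%E; apply: funext => w /=.
    rewrite FDP_SD_squash //; first congr (FDP_SD _ _ _).
      apply: eq_from_tnth => i; rewrite !(tnth_mix, tnth_mktuple).
      by case: (i \in I).
    by move=> j; rewrite Vcount_mixr => Kj; have := all_ge j; rewrite Kj.
  apply: hcontrol.
  - by move=> w; apply: cube_mix => //; exact: cube_squash.
  - by apply: PRDS_mix_rv => //; exact: cube_squash.
  - exact: indep_pvals_mix_rv.
  - exact: superuniform_mix_rv.
rewrite negb_forall => /existsP[j]; rewrite negb_imply -ltNge => /andP[Kj ajk].
(* Fewer than j + 1 false hypotheses have small p-values and [a j < k]: a
   rejected true null forces the complement of [E]. *)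
pose c i := Num.max (a i) k.
pose E := [set w | all (fun i => k < pval p i w) (enum I)].
have mE : measurable E := measurable_all_pval_gt p k (enum I).
have PE : ((1 - alpha)%:E <= P E)%E.
  apply: le_trans (PRDS_orthant p I k (enum I) pc prds su _ _).
  - by rewrite lee_fin -cardE.
  - by rewrite (ltW k_gt0).
  - by move=> i; rewrite mem_enum.
have -> : FDR_SD I c (mix_rv p I v)
        = (\int[P]_w (FDP_SD I c (mix I (p w) v))%:E)%E.
  by rewrite /FDR_SD unlock.
apply: (@le_trans _ _ (\int[P]_w (\1_(~` E) w)%:E)%E).
  apply: ge0_le_integral => //.
  - by move=> w _; rewrite lee_fin FDP_SD_ge0.
  - by apply/measurable_EFinP; exact: (measurable_FDP_SD (mix_rv p I v)).
  - by apply/measurable_EFinP/measurable_indic/measurableC.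
  - move=> w _; rewrite lee_fin.
    have -> : \1_(~` E) w =
        (~~ [forall i in I, k < tnth (mix I (p w) v) i])%:R :> R.
      rewrite indicE in_setC; congr (~~ _)%:R.
      apply/idP/forall_inP => [/set_mem /allP H i iI|H].
        by rewrite tnth_mix iI H // mem_enum.
      apply/mem_set/allP => i; rewrite mem_enum => iI.
      by have := H i iI; rewrite tnth_mix iI.
    by apply: FDP_SD_le_indic ajk => //; rewrite Vcount_mixr.
rewrite integral_indic ?setIT //; last exact: measurableC.
rewrite [leLHS](probability_setC P mE); move: PE.
rewrite (probability_fineK E mE) -EFinB !lee_fin; lra.
Qed.

End Probability.

Theorem lemma15 (R : realType) (n : nat) (hn : (1 <= n)%N)
  (alpha : R) (halpha : 0 < alpha < 1)
  (I0 I1 : {set 'I_n})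
  (hI : (I0 :|: I1)%SET = [set: 'I_n]%SET) (hdisj : [disjoint I0 & I1])
  (hI0 : (0 < #|I0|)%N)
  (a : 'I_n -> R)
  (ha_ge0 : forall i, 0 <= a i)
  (ha_mono : forall i j : 'I_n, (i <= j)%N -> a i <= a j)
  (hcontrol : SD_controls_FDR I0 I1 alpha a) :
  SD_controls_FDR I0 I1 alpha
    (fun i => Num.max (a i) (1 - (1 - alpha) `^ (n%:R^-1))).
Proof.
have I1E : I1 = (~: I0)%SET.
  apply/setP => i; have : i \in [set: 'I_n]%SET by rewrite inE.
  rewrite -hI !inE.
  by case: (boolP (i \in I0)) => //= iI _; rewrite (disjointFr hdisj iI).
subst I1; have /andP[alpha_gt0 alpha_lt1] := halpha.
set k := 1 - _.
have kn : (1 - k) ^+ n = 1 - alpha.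
  rewrite /k subKr -powR_mulrn ?powR_ge0 // -powRrM mulVf ?powRr1 //.
  - by lra.
  - by rewrite pnatr_eq0 -lt0n.
have k_le1 : 0 <= 1 - k by rewrite /k subKr powR_ge0.
have k_gt0 : 0 < k.
  rewrite ltNge; apply/negP => k0.
  have : 1 <= (1 - k) ^+ n by rewrite exprn_ege1 //; lra.
  by rewrite kn; lra.
apply: SD_controls_FDR_raise hcontrol => //.
  by rewrite k_gt0; lra.
rewrite -kn ler_wiXn2l //; first by lra.
by rewrite -[leqRHS]card_ord max_card.
Qed.
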